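(* Let $\mathbb{K}$ be a field. The association $\mathcal{G}:(\mathcal{A},\mathbb{V},D,\gamma)\longmapsto((\mathcal{A}\oplus\mathcal{A},\star),\mathbb{V},D,\gamma)$ gives a covariant functor from $\widetilde{\mathcal{S}pec}$ to $\widetilde{\mathcal{S}pec_{sub}}$.
   Context: An even algebraic spectral triple $(\mathcal{A},\mathbb{V},D,\gamma)$ over $\mathbb{K}$ consists of a unital associative $\mathbb{K}$-algebra $\mathcal{A}$, a $\mathbb{K}$-vector space $\mathbb{V}$ with a unital representation $\pi:\mathcal{A}\to\mathcal{E}nd(\mathbb{V})$, a linear operator $D\in\mathcal{E}nd(\mathbb{V})$, and a $\mathbb{Z}_2$-grading operator $\gamma\in\mathcal{E}nd(\mathbb{V})$ (so $\gamma^2=1$) which commutes with every $\pi(a)$ and anticommutes with $D$. Objects of $\widetilde{\mathcal{S}pec}$ are the even algebraic spectral triples. A morphism $(\mathcal{A}_1,\mathbb{V}_1,D_1,\gamma_1)\to(\mathcal{A}_2,\mathbb{V}_2,D_2,\gamma_2)$ is a pair $(\phi,\Phi)$ with $\phi:\mathcal{A}_1\to\mathcal{A}_2$ a unital algebra morphism and $\Phi:\mathbb{V}_1\to\mathbb{V}_2$ a surjective linear map such that $\Phi D_1=D_2\Phi$, $\Phi\gamma_1=\gamma_2\Phi$ and $\Phi\pi_1(x)=\pi_2(\phi(x))\Phi$ for all $x\in\mathcal{A}_1$. $\widetilde{\mathcal{S}pec_{sub}}$ is the subcategory whose objects are those $(\mathcal{A},\mathbb{V},D,\gamma)$ with $\gamma\in\pi(\mathcal{A})$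 (with the same morphisms). The product $\star$ on $\mathcal{A}\oplus\mathcal{A}$ is $(a,b)\star(\bar a,\bar b):=(a\bar a+b\bar b,\,a\bar b+b\bar a)$, with unit $(1,0)$. The algebra $(\mathcal{A}\oplus\mathcal{A},\star)$ is represented on $\mathbb{V}$ by $(a,b)\mapsto\pi(a)+\gamma\pi(b)$, so $(0,1)$ acts as $\gamma$. On morphisms $\mathcal{G}$ is $(\phi,\Phi)\mapsto(\widetilde\phi,\Phi)$ with $\widetilde\phi(a,b)=(\phi(a),\phi(b))$. *)

(* Defs.v *)
From HB Require Import structures.
From mathcomp Require Import all_boot all_algebra.
From Stdlib Require Import ProofIrrelevance.

Set Implicit Arguments.
Unset Strict Implicit.
Unset Printing Implicit Defensive.

Import GRing.Theory.
Local Open Scope ring_scope.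

Record category := Category {
  ob :> Type;
  homset : ob -> ob -> Type;
  idm : forall X, homset X X;
  comp : forall X Y Z, homset Y Z -> homset X Y -> homset X Z;
  comp_idl : forall X Y (f : homset X Y), comp (idm Y) f = f;
  comp_idr : forall X Y (f : homset X Y), comp f (idm X) = f;
  comp_assoc : forall W X Y Z (h : homset Y Z) (g : homset X Y) (f : homset W X),
    comp h (comp g f) = comp (comp h g) f
}.
Arguments homset {c} X Y.
Arguments idm {c} X.
Arguments comp {c X Y Z} g f.

Record functor (C D : category) := Functor {
  fob :> C -> D;
  fmap : forall X Y : C, homset X Y -> homset (fob X) (fob Y);
  fmap_id : forall X : C, fmap (idm X) = idm (fob X);
  fmap_comp : forall (X Y Z : C) (g : homset Y Z) (f : homset X Y),
    fmap (comp g f) = comp (fmap g) (fmap f)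
}.
Arguments fmap {C D} _ {X Y} _.

Definition full_subcategory (C : category) (P : C -> Prop) : category :=
  @Category {X : C | P X} (fun X Y => homset (sval X) (sval Y))
    (fun X => idm (sval X)) (fun X Y Z g f => comp g f)
    (fun X Y f => comp_idl f) (fun X Y f => comp_idr f)
    (fun W X Y Z h g f => comp_assoc h g f).

(* MathComp's [algType] forces [1 != 0]; the zero algebra is allowed here, so
   an algebra is a K-module with a product and a unit subject to
   [is_unital_algebra]. *)
Record algebra_data (K : fieldType) := AlgebraData {
  acarrier :> lmodType K;
  amul : acarrier -> acarrier -> acarrier;
  aone : acarrier
}.
Arguments amul {K a} x y.
Arguments aone {K} a.

Definition is_unital_algebra (K : fieldType) (A : algebra_data K) : Prop :=
  [/\ associative (@amul K A),
      left_id (aone A) amul,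
      right_id (aone A) amul,
      forall a : A, linear (amul a)
    & forall b : A, linear (fun a : A => amul a b)].

Definition is_unital_algebra_morphism (K : fieldType) (A B : algebra_data K)
    (phi : A -> B) : Prop :=
  [/\ linear phi, phi (aone A) = aone B
    & {morph phi : x y / amul x y >-> amul x y}].

Definition is_unital_representation (K : fieldType) (A : algebra_data K)
    (V : lmodType K) (pi : A -> {linear V -> V}) : Prop :=
  [/\ forall v : V, linear (fun a : A => pi a v),
      pi (aone A) =1 id
    & forall a b : A, pi (amul a b) =1 pi a \o pi b].

Record triple_data (K : fieldType) := TripleData {
  talg : algebra_data K;
  tspace : lmodType K;
  trep : talg -> {linear tspace -> tspace};
  tD : {linear tspace -> tspace};
  tgamma : {linear tspace -> tspace}
}.
Arguments trep {K t} a.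
Arguments tD {K} t.
Arguments tgamma {K} t.

Definition is_even_spectral_triple (K : fieldType) (T : triple_data K) : Prop :=
  [/\ is_unital_algebra (talg T),
      is_unital_representation (@trep K T),
      tgamma T \o tgamma T =1 id,
      forall a : talg T, tgamma T \o trep a =1 trep a \o tgamma T
    & forall v, tgamma T (tD T v) = - tD T (tgamma T v)].

Record mor_data (K : fieldType) (S T : triple_data K) := MorData {
  mphi : talg S -> talg T;
  mPhi : tspace S -> tspace T
}.

Definition is_triple_morphism (K : fieldType) (S T : triple_data K)
    (f : mor_data S T) : Prop :=
  [/\ is_unital_algebra_morphism (mphi f),
      linear (mPhi f),
      (forall w, exists v, mPhi f v = w)
    & [/\ mPhi f \o tD S =1 tD T \o mPhi f,
          mPhi f \o tgamma S =1 tgamma T \o mPhi f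
        & forall x : talg S, mPhi f \o trep x =1 trep (mphi f x) \o mPhi f]].

Definition id_data (K : fieldType) (T : triple_data K) : mor_data T T :=
  @MorData K T T id id.

Definition comp_data (K : fieldType) (R S T : triple_data K)
    (g : mor_data S T) (f : mor_data R S) : mor_data R T :=
  @MorData K R T (mphi g \o mphi f) (mPhi g \o mPhi f).

Lemma id_data_morphism (K : fieldType) (T : triple_data K) :
  is_triple_morphism (id_data T).
Proof. by split; [split | | move=> w; exists w | split]. Qed.

Lemma comp_data_morphism (K : fieldType) (R S T : triple_data K)
    (g : mor_data S T) (f : mor_data R S) :
  is_triple_morphism g -> is_triple_morphism f ->
  is_triple_morphism (comp_data g f).
Proof.
move=> [[lg g1 gM] lG sG [GD Gg Gp]] [[lf f1 fM] lF sF [FD Fg Fp]].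
split.
- split=> [k x y||x y] /=; first by rewrite lf lg.
    by rewrite f1 g1.
  by rewrite fM gM.
- by move=> k x y /=; rewrite lF lG.
- by move=> w; have [v <-] := sG w; have [u <-] := sF v; exists u.
- split=> [v|v|x v] /=.
  + by rewrite (FD v : mPhi f _ = _) (GD _ : mPhi g _ = _).
  + by rewrite (Fg v : mPhi f _ = _) (Gg _ : mPhi g _ = _).
  + by rewrite (Fp x v : mPhi f _ = _) (Gp _ _ : mPhi g _ = _).
Qed.

Definition even_spectral_triple (K : fieldType) :=
  {T : triple_data K | is_even_spectral_triple T}.

Definition triple_morphism (K : fieldType) (S T : even_spectral_triple K) :=
  {f : mor_data (sval S) (sval T) | is_triple_morphism f}.

Lemma triple_morphism_eq (K : fieldType) (S T : even_spectral_triple K)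
    (f g : triple_morphism S T) : sval f = sval g -> f = g.
Proof.
case: f g => [f Hf] [g Hg] /= E; case: _ / E Hg => Hg.
by congr exist; exact: proof_irrelevance.
Qed.

Definition Spec (K : fieldType) : category.
Proof.
refine (@Category (even_spectral_triple K) (@triple_morphism K)
  (fun T => exist _ (id_data (sval T)) (id_data_morphism (sval T)))
  (fun R S T g f => exist _ (comp_data (sval g) (sval f))
     (comp_data_morphism (svalP g) (svalP f))) _ _ _).
- by move=> S T f; apply: triple_morphism_eq; case: f => [[? ?] ?].
- by move=> S T f; apply: triple_morphism_eq; case: f => [[? ?] ?].
- by move=> *; apply: triple_morphism_eq.
Defined.

Definition Spec_sub (K : fieldType) : category :=
  @full_subcategory (Spec K) (fun T : even_spectral_triple K =>
    exists a : talg (sval T), trep a =1 tgamma (sval T)).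

Definition star_algebra (K : fieldType) (A : algebra_data K) : algebra_data K :=
  @AlgebraData K (A * A)%type
    (fun x y => (amul x.1 y.1 + amul x.2 y.2, amul x.1 y.2 + amul x.2 y.1))
    (aone A, 0).

Definition G_ob (K : fieldType) (T : triple_data K) : triple_data K :=
  @TripleData K (star_algebra (talg T)) (tspace T)
    (fun x => trep x.1 \+ (tgamma T \o trep x.2)) (tD T) (tgamma T).

Definition G_mor (K : fieldType) (S T : triple_data K) (f : mor_data S T) :
    mor_data (G_ob S) (G_ob T) :=
  @MorData K (G_ob S) (G_ob T) (fun x => (mphi f x.1, mphi f x.2)) (mPhi f).

(* A morphism packed with its source and target, so that morphisms whose
   endpoints are only propositionally equal can be compared. *)
Record arrow_data (K : fieldType) := ArrowData {
  asrc : triple_data K;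
  atgt : triple_data K;
  amor : mor_data asrc atgt
}.

Definition spec_data (K : fieldType) (T : Spec K) : triple_data K := sval T.
Definition spec_arrow (K : fieldType) (S T : Spec K) (f : homset S T) :
  arrow_data K := ArrowData (sval f).
Definition sub_data (K : fieldType) (T : Spec_sub K) : triple_data K :=
  sval (sval T).
Definition sub_arrow (K : fieldType) (S T : Spec_sub K) (f : homset S T) :
  arrow_data K := ArrowData (sval f).

Definition G_arrow (K : fieldType) (f : arrow_data K) : arrow_data K :=
  ArrowData (G_mor (amor f)).

(* Main.v *)
(* The product [star] is that of the group algebra A[Z/2]: (a, b) stands for
   a + b u with u central and u^2 = 1. Since gamma commutes with pi(A) and
   gamma^2 = 1, sending u to gamma extends pi to A[Z/2] and puts gamma in the
   image. Everything is natural in (phi, Phi) because Phi intertwines the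
   gradings. *)
Require Import Defs.
From mathcomp Require Import all_boot all_algebra.
From Stdlib Require Import FunctionalExtensionality.

Set Implicit Arguments.
Unset Strict Implicit.
Unset Printing Implicit Defensive.

Import GRing.Theory.
Local Open Scope ring_scope.

Section LinearProp.
Variables (K : fieldType) (U V : lmodType K) (f : U -> V).
Hypothesis f_lin : linear f.

(** Linearity enters the definitions as a predicate on bare functions, so additivity is extracted
    from it at scalar 1. *)
Lemma linear_propD x y : f (x + y) = f x + f y.
Proof. by have := f_lin 1 x y; rewrite !scale1r. Qed.

Lemma linear_prop0 : f 0 = 0.
Proof.
by have /eqP := linear_propD 0 0; rewrite addr0 addrC -subr_eq subrr => /eqP.
Qed.

End LinearProp.

Section StarAlgebra.
Variables (K : fieldType) (A : algebra_data K).
Hypothesis A_alg : is_unital_algebra A.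

Lemma amulDr (a b c : A) : amul a (b + c) = amul a b + amul a c.
Proof. by case: A_alg => _ _ _ lin _; exact: linear_propD. Qed.

Lemma amulDl (a b c : A) : amul (a + b) c = amul a c + amul b c.
Proof. by case: A_alg => _ _ _ _ lin; exact: (linear_propD (lin c)). Qed.

Lemma amul0r (a : A) : amul 0 a = 0.
Proof. by case: A_alg => _ _ _ _ lin; exact: (linear_prop0 (lin a)). Qed.

Lemma amulr0 (a : A) : amul a 0 = 0.
Proof. by case: A_alg => _ _ _ lin _; exact: linear_prop0. Qed.

Lemma star_algebra_unital : is_unital_algebra (star_algebra A).
Proof.
have [mulA mul1 mulr1 linr linl] := A_alg.
split.
- move=> [a1 a2] [b1 b2] [c1 c2]; rewrite /amul /=.
  rewrite !amulDr !amulDl !mulA.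
  (* In each component both sides are sums of the same four triple products; swapping the last two
     and exchanging the middle ones matches them. *)
  by congr pair; rewrite [X in _ + X = _]addrC addrACA.
- by move=> [a1 a2]; rewrite /amul /= !mul1 !amul0r !addr0.
- by move=> [a1 a2]; rewrite /amul /= !mulr1 !amulr0 add0r addr0.
- move=> [a1 a2] k [b1 b2] [c1 c2]; rewrite /amul /= !linr.
  by congr pair; rewrite /= scalerDr addrACA.
- move=> [c1 c2] k [a1 a2] [b1 b2]; rewrite /amul /=.
  rewrite (linl c1 k a1 b1) (linl c2 k a2 b2) (linl c2 k a1 b1) (linl c1 k a2 b2).
  by congr pair; rewrite /= scalerDr addrACA.
Qed.

End StarAlgebra.

Lemma G_ob_even_spectral_triple (K : fieldType) (T : triple_data K) :
  is_even_spectral_triple T -> is_even_spectral_triple (G_ob T).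
Proof.
move=> [T_alg [replin rep1 repM] gg gC gD].
have gammaK v : tgamma T (tgamma T v) = v := gg v.
have gammaC (a : talg T) v : tgamma T (trep a v) = trep a (tgamma T v) := gC a v.
have repMv (a b : talg T) v : trep (amul a b) v = trep a (trep b v) := repM a b v.
have repDv (a b : talg T) v : trep (a + b) v = trep a v + trep b v :=
  linear_propD (replin v) a b.
have rep0v v : trep (0 : talg T) v = 0 := linear_prop0 (replin v).
(* [G_ob] keeps [tD] and [tgamma], so the involution and anticommutation conditions carry over;
   those involving the algebra remain. *)
split=> //.
- exact: star_algebra_unital.
- split.
  + move=> v k [a1 a2] [b1 b2] /=.
    rewrite (replin v k a1 b1) (replin v k a2 b2) linearP.
    by rewrite scalerDr addrACA.
  + by move=> v /=; rewrite rep1 rep0v linear0 addr0.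
  + move=> [a1 a2] [b1 b2] v /=.
    (* Every gamma is moved to the left, where the two in the product of the second components
       cancel. *)
    rewrite !repDv !repMv !linearD /= -!gammaC gammaK.
    by rewrite [X in _ = _ + X]addrC [RHS]addrACA.
- by move=> [a1 a2] v /=; rewrite linearD /= !gammaC.
Qed.

Lemma G_ob_gamma_in_image (K : fieldType) (T : triple_data K) :
  is_even_spectral_triple T ->
  exists a : talg (G_ob T), trep a =1 tgamma (G_ob T).
Proof.
(* The witness is the generator u, acting as pi(0) + gamma pi(1). *)
move=> [_ [replin rep1 _] _ _ _]; exists (0, aone (talg T)) => v /=.
by rewrite rep1 (linear_prop0 (replin v)) add0r.
Qed.

Lemma G_mor_triple_morphism (K : fieldType) (S T : triple_data K)
    (f : mor_data S T) :
  is_triple_morphism f -> is_triple_morphism (G_mor f).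
Proof.
move=> [[lphi phi1 phiM] lPhi sPhi [PhiD Phig Phirep]].
split=> //; split=> //.
- by move=> k [a1 a2] [b1 b2] /=; rewrite !lphi.
- by rewrite /= phi1 (linear_prop0 lphi).
- move=> [a1 a2] [b1 b2]; rewrite /amul /=.
  by rewrite !(linear_propD lphi) !phiM.
(* In the second summand Phi must pass gamma before it can pass pi(a2). *)
- move=> [a1 a2] v /=; rewrite (linear_propD lPhi).
  rewrite (Phirep a1 v : mPhi f _ = trep _ (mPhi f v)).
  rewrite (Phig _ : mPhi f _ = tgamma T (mPhi f _)).
  by rewrite (Phirep a2 v : mPhi f _ = trep _ (mPhi f v)).
Qed.

(** The map x |-> (x.1, x.2) reduces to the identity only on explicit pairs, hence the
    extensionality. *)
Lemma G_mor_id (K : fieldType) (T : triple_data K) :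
  G_mor (id_data T) = id_data (G_ob T).
Proof. by congr MorData; apply: functional_extensionality => -[]. Qed.

Definition G_spec_ob (K : fieldType) (T : Spec K) : Spec_sub K :=
  exist _ (exist _ (G_ob (sval T)) (G_ob_even_spectral_triple (svalP T)))
    (G_ob_gamma_in_image (svalP T)).

Definition G_spec_mor (K : fieldType) (S T : Spec K) (f : homset S T) :
    homset (G_spec_ob S) (G_spec_ob T) :=
  exist _ (G_mor (sval f)) (G_mor_triple_morphism (svalP f)).

Lemma G_spec_mor_id (K : fieldType) (T : Spec K) :
  G_spec_mor (idm T) = idm (G_spec_ob T).
Proof. by apply: triple_morphism_eq; exact: G_mor_id. Qed.

(** Unlike for identities, the underlying maps agree by computation, as projections of explicit
    pairs reduce. *)
Lemma G_spec_mor_comp (K : fieldType) (R S T : Spec K)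
    (g : homset S T) (f : homset R S) :
  G_spec_mor (Defs.comp g f) = Defs.comp (G_spec_mor g) (G_spec_mor f).
Proof. exact: triple_morphism_eq. Qed.

Theorem proposition2p9 (K : fieldType) :
  exists G : functor (Spec K) (Spec_sub K),
    (forall T : Spec K, sub_data (G T) = G_ob (spec_data T)) /\
    (forall (S T : Spec K) (f : homset S T),
        sub_arrow (fmap G f) = G_arrow (spec_arrow f)).
Proof.
by exists (Functor (@G_spec_mor_id K) (@G_spec_mor_comp K)).
Qed.
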